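(* The class of nested matroids is well-quasi-ordered under the minor order (with isomorphic matroids identified); that is, there is no infinite set of nested matroids none of which is isomorphic to a minor of another.
   Context: A nested matroid is a matroid that can be obtained from the empty matroid by iterating the operations of adding an isthmus (coloop) and taking a free extension. The free extension $M+e$ ($e\notin E(M)$) is the matroid on $E(M)\cup e$ whose circuits are those of $M$ together with the sets $B\cup e$ for bases $B$ of $M$. *)

(* Defs.v *)
From mathcomp Require Import all_boot.

Set Implicit Arguments.
Unset Strict Implicit.
Unset Printing Implicit Defensive.

(* A matroid is given by its ground set, a subset of an ambient finite type T,
   and its independent sets.  The axioms are boolean, so that two matroids on T
   with the same ground set and the same independent sets are equal. *)

Definition matroid_axioms (T : finType) (E : {set T}) (I : {set {set T}}) :=
  [&& set0 \in I,
      [forall A in I, A \subset E],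
      [forall A in I, forall B : {set T}, (B \subset A) ==> (B \in I)]
    & [forall A in I, forall B in I,
         (#|A| < #|B|) ==> [exists x in B :\: A, x |: A \in I]]].

Record matroid (T : finType) := Matroid {
  ground : {set T};
  indep : {set {set T}};
  matroidP : matroid_axioms ground indep
}.

Definition is_circuit (T : finType) (M : matroid T) (C : {set T}) : bool :=
  minset (fun D : {set T} => (D \subset ground M) && (D \notin indep M)) C.

(* Maximal independent subsets of X; the bases of M are those of ground M. *)
Definition is_basis_of (T : finType) (M : matroid T) (X B : {set T}) : bool :=
  maxset (fun A : {set T} => (A \in indep M) && (A \subset X)) B.

Definition circuits (T : finType) (M : matroid T) : {set {set T}} :=
  [set C | is_circuit M C].

Definition bases (T : finType) (M : matroid T) : {set {set T}} :=
  [set B | is_basis_of M (ground M) B].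

Section MatroidTheory.
Variable T : finType.
Implicit Types (M N : matroid T) (A B C D I J X : {set T}) (e x : T).

Lemma matroid_axiomsP (E : {set T}) (F : {set {set T}}) :
  reflect [/\ set0 \in F,
              forall A, A \in F -> A \subset E,
              forall A B, A \in F -> B \subset A -> B \in F
            & forall A B, A \in F -> B \in F -> #|A| < #|B| ->
                exists x, [/\ x \in B, x \notin A & x |: A \in F]]
          (matroid_axioms E F).
Proof.
apply: (iffP and4P) => [[F0 /forall_inP FE /forall_inP Fs /forall_inP Fa]|].
  split=> // [A B AF BA|A B AF BF ltAB].
    exact: (implyP (forallP (Fs A AF) B) BA).
  have /exists_inP[x] := implyP (forall_inP (Fa A AF) B BF) ltAB.
  by rewrite inE => /andP[xA xB] xAF; exists x.
move=> [F0 FE Fs Fa]; split=> //.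
- exact/forall_inP.
- apply/forall_inP => A AF; apply/forallP => B; apply/implyP; exact: Fs.
- apply/forall_inP => A AF; apply/forall_inP => B BF; apply/implyP => ltAB.
  have [x [xB xA xAF]] := Fa A B AF BF ltAB.
  by apply/exists_inP; exists x; rewrite // inE xA.
Qed.

Lemma indep0 M : set0 \in indep M.
Proof. by case/matroid_axiomsP: (matroidP M). Qed.

Lemma indep_ground M A : A \in indep M -> A \subset ground M.
Proof. by case/matroid_axiomsP: (matroidP M) => _ + _ _; apply. Qed.

Lemma indepS M A B : A \in indep M -> B \subset A -> B \in indep M.
Proof. by case/matroid_axiomsP: (matroidP M) => _ _ + _; apply. Qed.

Lemma indep_aug M A B : A \in indep M -> B \in indep M -> #|A| < #|B| ->
  exists x, [/\ x \in B, x \notin A & x |: A \in indep M].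
Proof. by case/matroid_axiomsP: (matroidP M) => _ _ _; apply. Qed.

Lemma matroid_inj M N : ground M = ground N -> indep M = indep N -> M = N.
Proof.
case: M N => [E F p] [E' F' p'] /= eE eF; move: p p'; rewrite eE eF => p p'.
by rewrite (bool_irrelevance p p').
Qed.

Lemma basis_ofP M X B :
  reflect [/\ B \in indep M, B \subset X
            & forall A, A \in indep M -> A \subset X -> #|A| <= #|B|]
          (is_basis_of M X B).
Proof.
apply: (iffP maxsetP) => [[/andP[BI BX] Bmax]|[BI BX Bmax]].
  split=> // A AI AX; rewrite leqNgt; apply/negP => ltBA.
  have [x [xA xB xBI]] := indep_aug BI AI ltBA.
  have eqB : x |: B = B.
    by apply: Bmax; rewrite ?subsetU1 // xBI subUset sub1set BX (subsetP AX).
  by rewrite -eqB setU11 in xB.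
split=> [|A /andP[AI AX] BA]; first exact/andP.
by apply/esym/eqP; rewrite eqEcard BA Bmax.
Qed.

Lemma basis_of_exists M X : exists B, is_basis_of M X B.
Proof.
have p0 : (set0 \in indep M) && (set0 \subset X) by rewrite indep0 sub0set.
by have [B Bmax _] := @maxset_exists _ (fun A => (A \in indep M) && (A \subset X)) _ p0; exists B.
Qed.

Lemma indepPn M A : A \subset ground M ->
  reflect (exists2 C, C \in circuits M & C \subset A) (A \notin indep M).
Proof.
move=> AE; apply: (iffP idP) => [AI|[C + CA]].
  have pA : (A \subset ground M) && (A \notin indep M) by rewrite AE.
  have [C Cmin CA] :=
      @minset_exists _ (fun D => (D \subset ground M) && (D \notin indep M)) _ pA.
    by exists C; rewrite // inE.
rewrite inE => /minsetP[/andP[_ CI] _].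
by apply: contra CI => /indepS; apply.
Qed.

Fact empty_matroid_axioms : matroid_axioms (set0 : {set T}) [set set0].
Proof.
apply/matroid_axiomsP; split=> [|A|A B|A B]; rewrite ?inE //.
- by move=> /eqP->.
- by move=> /eqP->; rewrite subset0.
- by move=> /eqP-> /eqP->; rewrite ltnn.
Qed.

Definition empty_matroid : matroid T := Matroid empty_matroid_axioms.

Fact delete_axioms M X :
  matroid_axioms (ground M :\: X)
    [set I in indep M | I \subset ground M :\: X].
Proof.
apply/matroid_axiomsP; split=> [|A|A B|A B]; rewrite !inE //.
- by rewrite indep0 sub0set.
- by case/andP.
- by move=> /andP[AI AE] BA; rewrite (indepS AI BA) (subset_trans BA AE).
- move=> /andP[AI AE] /andP[BI BE] ltAB.
  have [x [xB xA xAI]] := indep_aug AI BI ltAB.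
  by exists x; rewrite inE xAI subUset sub1set AE (subsetP BE) // xB xA.
Qed.

Definition delete M X : matroid T := Matroid (delete_axioms M X).

Fact contract_axioms M X :
  matroid_axioms (ground M :\: X)
    [set I : {set T} | (I \subset ground M :\: X) &&
       [exists B : {set T}, is_basis_of M X B && (I :|: B \in indep M)]].
Proof.
apply/matroid_axiomsP; split=> [|A|A B|A B]; rewrite !inE //.
- rewrite sub0set; have [B BX] := basis_of_exists M X.
  by apply/existsP; exists B; rewrite BX set0U; case/basis_ofP: BX.
- by case/andP.
- move=> /andP[AE /existsP[D /andP[DX ADI]]] BA.
  rewrite (subset_trans BA AE); apply/existsP; exists D.
  by rewrite DX (indepS ADI) // setSU.
move=> /andP[AE /existsP[D /andP[DX ADI]]].
move=> /andP[BE /existsP[D' /andP[D'X BDI]]] ltAB.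
have [DI sDX Dmax] := basis_ofP _ _ _ DX.
have [D'I sD'X D'max] := basis_ofP _ _ _ D'X.
have cD : #|D| <= #|D'| by exact: D'max.
have dis (Z W : {set T}) : Z \subset ground M :\: X -> W \subset X ->
    #|Z :|: W| = #|Z| + #|W|.
  move=> ZE WX; apply/eqP; rewrite (leq_card_setU Z W) -setI_eq0 -subset0.
  apply/subsetP=> y /setIP[/(subsetP ZE)].
  by rewrite inE => /andP[/negP yX _] /(subsetP WX) /yX.
have lt : #|A :|: D| < #|B :|: D'|.
  by rewrite !dis // -addSn leq_add.
have [x []] := indep_aug ADI BDI lt.
rewrite !inE negb_or => xBD /andP[xA xD] xI.
have xB : x \in B.
  case/orP: xBD => // xD'.
  have xDI : x |: D \in indep M by apply: indepS xI _; rewrite setUS // subsetUr.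
  have := Dmax _ xDI; rewrite subUset sub1set (subsetP sD'X) // sDX.
  by rewrite cardsU1 xD ltnn => /(_ isT).
exists x; split=> //; rewrite inE subUset sub1set (subsetP BE) // AE.
by apply/existsP; exists D; rewrite DX -setUA.
Qed.

Definition contract M X : matroid T := Matroid (contract_axioms M X).

Fact add_isthmus_axioms M e :
  matroid_axioms (e |: ground M) [set I : {set T} | I :\ e \in indep M].
Proof.
apply/matroid_axiomsP; split=> [|A|A B|A B]; rewrite !inE //.
- by rewrite set0D indep0.
- by move/indep_ground; rewrite subDset.
- by move=> AI BA; rewrite (indepS AI) // setSD.
move=> AI BI ltAB.
have [/andP[eB eA]|nAB] := boolP ((e \in B) && (e \notin A)).
  exists e; split; rewrite // inE setU1K //.
  by apply: indepS AI _; rewrite subsetD1 subxx.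
have lt : #|A :\ e| < #|B :\ e|.
  move: ltAB nAB; rewrite (cardsD1 e A) (cardsD1 e B).
  case: (e \in A); case: (e \in B); rewrite //= ?add0n ?add1n ?ltnS //.
  by move=> /ltnW.
have [x []] := indep_aug AI BI lt; rewrite !inE => /andP[xe xB].
rewrite xe /= => xA xI; exists x; split=> //; rewrite inE.
suff -> : (x |: A) :\ e = x |: A :\ e by [].
by apply/setP => y; rewrite !inE; case: (eqVneq y x) => // ->; rewrite xe.
Qed.

Definition add_isthmus M e : matroid T := Matroid (add_isthmus_axioms M e).

Lemma bases_add_isthmus M e : e \notin ground M ->
  bases (add_isthmus M e) = [set e |: B | B in bases M].
Proof.
move=> eM; have eI A : A \in indep M -> e \notin A.
  by move/indep_ground/subsetP=> AE; apply: contra eM => /AE.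
apply/setP => B; apply/idP/imsetP => [|[A + ->]]; rewrite !inE.
  case/basis_ofP; rewrite /= inE => BI BE Bmax.
  have eB : e \in B.
    apply/negPn/negP => eB; have := Bmax (e |: B).
    rewrite inE setU1K // subUset sub1set setU11 BE cardsU1 eB ltnn.
    have -> : B = B :\ e by apply/esym/setDidPl; rewrite disjoint_sym disjoints1.
    by move=> /(_ BI isT).
  exists (B :\ e); last by rewrite setD1K.
  rewrite inE; apply/basis_ofP; split=> // [|A AI AE]; first by rewrite subDset.
  have := Bmax (e |: A); rewrite inE setU1K ?eI // setUS //.
  by rewrite cardsU1 eI // (cardsD1 e B) eB ltnS => /(_ AI isT).
case/basis_ofP => AI AE Amax; apply/basis_ofP => /=.
rewrite inE setU1K ?eI // setUS //; split=> // D; rewrite inE => DI _.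
rewrite cardsU1 eI // (cardsD1 e D) leq_add ?leq_b1 // Amax //.
exact: indep_ground.
Qed.

Definition free_extension_circuits M e : {set {set T}} :=
  circuits M :|: [set e |: B | B in bases M].

Definition free_extension_indep M e : {set {set T}} :=
  [set I : {set T} | (I \subset e |: ground M) &&
     [forall C in free_extension_circuits M e, ~~ (C \subset I)]].

Lemma free_extension_indepP M e I : e \notin ground M ->
  reflect (I :\ e \in indep M /\
             (e \in I -> exists2 J, J \in indep M & #|I :\ e| < #|J|))
          (I \in free_extension_indep M e).
Proof.
move=> eM; rewrite inE; apply: (iffP andP) => [[IE /forall_inP Ic]|[II eI]].
  have IeE : I :\ e \subset ground M by rewrite subDset.
  have II : I :\ e \in indep M.
    apply/negPn/(indepPn IeE) => -[C CM CI].
    have := Ic C; rewrite inE CM => /(_ isT) /negP; apply.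
    by apply: subset_trans CI _; rewrite subD1set.
  split=> // eI; have [B BM] := basis_of_exists M (ground M).
  have [BI BE Bmax] := basis_ofP _ _ _ BM.
  exists B => //; rewrite ltnNge; apply/negP => leBI.
  have IM : I :\ e \in bases M.
    rewrite inE; apply/basis_ofP; split=> // A AI AE.
    exact: leq_trans (Bmax A AI AE) leBI.
  suff IF : I \in free_extension_circuits M e by have := Ic I IF; rewrite subxx.
  rewrite inE.
  by apply/orP; right; apply/imsetP; exists (I :\ e); rewrite // setD1K.
have IE : I \subset e |: ground M by rewrite -subDset indep_ground.
split=> //; apply/forall_inP => C; rewrite inE => /orP[CM|/imsetP[B BM ->]].
  apply/negP => CI; have: I :\ e \notin indep M.
    apply/indepPn; first by rewrite subDset.
    exists C => //; rewrite subsetD1 CI /=; apply: contra eM => eC.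
    move: CM; rewrite inE => /minsetP[/andP[CE _] _]; exact: (subsetP CE).
  by rewrite II.
apply/negP; rewrite subUset sub1set => /andP[eI' BI].
have [J JI] := eI eI'; rewrite ltnNge => /negP; apply.
move: BM; rewrite inE => /basis_ofP[_ BE Bmax].
apply: leq_trans (Bmax J JI (indep_ground JI)) _; apply: subset_leq_card.
by rewrite subsetD1 BI; apply: contra eM; apply: (subsetP BE).
Qed.

Fact free_extension_axioms M e : e \notin ground M ->
  matroid_axioms (e |: ground M) (free_extension_indep M e).
Proof.
move=> eM; apply/matroid_axiomsP; split.
- apply/free_extension_indepP; rewrite // set0D indep0 inE; split=> //.
- by move=> A; rewrite inE => /andP[].
- move=> A B /(free_extension_indepP _ eM)[AI eA] BA.
  have sBA : B :\ e \subset A :\ e by rewrite setSD.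
  apply/(free_extension_indepP _ eM); split; first exact: indepS AI _.
  move=> /(subsetP BA) /eA[J JI lt]; exists J => //.
  exact: leq_ltn_trans (subset_leq_card sBA) lt.
move=> A B /(free_extension_indepP _ eM)[AI eA].
move=> /(free_extension_indepP _ eM)[BI eB] ltAB.
have [lt|ge] := ltnP #|A :\ e| #|B :\ e|; last first.
  have [eB' eA'] : e \in B /\ e \notin A.
    move: ltAB ge; rewrite (cardsD1 e A) (cardsD1 e B).
    case: (e \in A); case: (e \in B); rewrite /= ?add0n ?add1n ?ltnS //.
    - by move=> h /(leq_trans h); rewrite ltnn.
    - by move=> h /(leq_trans h)/ltnW; rewrite ltnn.
    - by move=> h /(leq_trans h); rewrite ltnn.
  have AeE : A :\ e = A by apply/setDidPl; rewrite disjoint_sym disjoints1.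
  have [J JI ltJ] := eB eB'.
  exists e; split=> //; apply/(free_extension_indepP _ eM); rewrite setU1K //.
  split=> [|_]; first by rewrite -AeE.
  exists J => //; apply: leq_ltn_trans ltJ.
  by move: ltAB; rewrite (cardsD1 e B) eB' ltnS.
have [x []] := indep_aug AI BI lt; rewrite !inE => /andP[xe xB].
rewrite xe /= => xA xI; exists x; split=> //.
have E : (x |: A) :\ e = x |: A :\ e.
  by apply/setP => y; rewrite !inE; case: (eqVneq y x) => // ->; rewrite xe.
apply/(free_extension_indepP _ eM); rewrite E; split=> //.
rewrite !inE eq_sym (negbTE xe) /= => eA'.
have c : #|x |: A :\ e| = #|A|.
  by rewrite cardsU1 !inE xe xA [in RHS](cardsD1 e A) eA'.
rewrite c; have [eB'|eB'] := boolP (e \in B).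
  have [J JI ltJ] := eB eB'; exists J => //.
  by apply: leq_trans ltJ; rewrite ltnS -c cardsU1 !inE xe xA.
exists (B :\ e) => //.
suff -> : B :\ e = B by [].
by apply/setDidPl; rewrite disjoint_sym disjoints1.
Qed.

Definition free_extension M e (eM : e \notin ground M) : matroid T :=
  Matroid (free_extension_axioms eM).

Lemma circuitP M C :
  reflect [/\ C \subset ground M, C \notin indep M
            & forall D, D \notin indep M -> D \subset C -> D = C]
          (C \in circuits M).
Proof.
rewrite inE; apply: (iffP minsetP) => [[/andP[CE CI] Cmin]|[CE CI Cmin]].
  by split=> // D DI DC; apply: Cmin; rewrite // DI (subset_trans DC CE).
by split=> [|D /andP[_ DI]]; [rewrite CE | apply: Cmin].
Qed.

Lemma free_extension_circuits_sub M e C :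
  C \in free_extension_circuits M e -> C \subset e |: ground M.
Proof.
rewrite in_setU => /orP[/circuitP[CE _ _]|/imsetP[B]].
  exact: subset_trans CE (subsetU1 _ _).
by rewrite inE => /basis_ofP[_ BE _] ->; rewrite setUS.
Qed.

Lemma free_extension_circuits_anti M e C D : e \notin ground M ->
  C \in free_extension_circuits M e -> D \in free_extension_circuits M e ->
  C \subset D -> C = D.
Proof.
move=> eM; rewrite !in_setU => /orP[/circuitP[CE CI _]|/imsetP[B BM ->]].
  move=> /orP[/circuitP[_ _ Dmin]|/imsetP[B BM ->]]; first exact: Dmin.
  move=> CB; case/negP: CI; move: BM; rewrite inE => /basis_ofP[BI _ _].
  apply: indepS BI _; apply/subsetP => x xC.
  move: (subsetP CB x xC); rewrite !inE => /orP[/eqP xe|//].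
  by move: eM; rewrite -xe (subsetP CE).
move: BM; rewrite inE => /basis_ofP[BI BE Bmax].
move=> /orP[/circuitP[DE _ _]|/imsetP[B' + ->]].
  rewrite subUset sub1set => /andP[/(subsetP DE)].
  by rewrite (negbTE eM).
rewrite inE => /basis_ofP[BI' BE' Bmax'].
rewrite subUset => /andP[_ sBB'].
have sB : B \subset B'.
  apply/subsetP => x xB; move: (subsetP sBB' x xB); rewrite !inE.
  by case/orP=> // /eqP xe; move: eM; rewrite -xe (subsetP BE).
by congr (_ |: _); apply/eqP; rewrite eqEcard sB Bmax.
Qed.

Lemma free_extension_dep M e D : D \subset e |: ground M ->
  reflect (exists2 C, C \in free_extension_circuits M e & C \subset D)
          (D \notin free_extension_indep M e).
Proof.
move=> DE; rewrite inE DE /= negb_forall.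
apply: (iffP existsP) => [[C]|[C CF CD]].
  by rewrite negb_imply negbK => /andP[CF CD]; exists C.
by exists C; rewrite negb_imply CF negbK.
Qed.

Lemma circuits_free_extension M e (eM : e \notin ground M) :
  circuits (free_extension eM) = circuits M :|: [set e |: B | B in bases M].
Proof.
rewrite -/(free_extension_circuits M e).
apply/setP => C; apply/circuitP/idP => /= [[CE CI Cmin]|CF].
  have [D DF DC] := free_extension_dep CE CI.
  suff <- : D = C by [].
  apply: Cmin => //; apply/free_extension_dep; last by exists D.
  exact: free_extension_circuits_sub.
have CE := free_extension_circuits_sub CF.
split=> // [|D DI DC]; first by apply/free_extension_dep => //; exists C.
have [C' C'F C'D] := free_extension_dep (subset_trans DC CE) DI.
have eqC := free_extension_circuits_anti eM C'F CF (subset_trans C'D DC).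
by apply/eqP; rewrite eqEsubset DC -eqC.
Qed.

End MatroidTheory.

Inductive nested (T : finType) : matroid T -> Prop :=
| nested_empty : nested (empty_matroid T)
| nested_isthmus (M : matroid T) (e : T) :
    e \notin ground M -> nested M -> nested (add_isthmus M e)
| nested_free (M : matroid T) (e : T) (eM : e \notin ground M) :
    nested M -> nested (free_extension eM).

Definition minor (T : finType) (N M : matroid T) : Prop :=
  exists X Y : {set T},
    [/\ X \subset ground M, Y \subset ground M, [disjoint X & Y]
      & N = delete (contract M X) Y].

(* The bijection is between the ground sets, not the ambient types: there need
   not be any function from T to T' when T' is empty. *)
Definition isomorphic (T T' : finType) (M : matroid T) (N : matroid T') : Prop :=
  exists2 f : {x : T | x \in ground M} -> {y : T' | y \in ground N},
    bijective f
  & forall I : {set {x : T | x \in ground M}},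
      ([set val (f x) | x in I] \in indep N) = ([set val x | x in I] \in indep M).

Definition finite_matroid : Type := {T : finType & matroid T}.

Definition nested_matroid (M : finite_matroid) : Prop := nested (projT2 M).

Definition minor_le (N M : finite_matroid) : Prop :=
  exists2 N' : matroid (projT1 M), minor N' (projT2 M) & isomorphic (projT2 N) N'.

Definition quasi_order_on (A : Type) (P : A -> Prop) (R : A -> A -> Prop) : Prop :=
  (forall x, P x -> R x x) /\
  (forall x y z, P x -> P y -> P z -> R x y -> R y z -> R x z).

Definition well_quasi_ordered (A : Type) (P : A -> Prop) (R : A -> A -> Prop) : Prop :=
  quasi_order_on P R /\
  (forall u : nat -> A, (forall i, P (u i)) -> exists i j, i < j /\ R (u i) (u j)).

Definition infinite_antichain (A : Type) (P : A -> Prop) (R : A -> A -> Prop) : Prop :=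
  exists u : nat -> A,
    [/\ injective u, forall i, P (u i) & forall i j, i <> j -> ~ R (u i) (u j)].

(* Main.v *)
Require Import Defs.
From mathcomp Require Import all_boot.
From Stdlib Require Import Classical IndefiniteDescription.

Set Implicit Arguments.
Unset Strict Implicit.
Unset Printing Implicit Defensive.

(* Building a nested matroid letter by letter gives a word over {isthmus, free
   extension}.  Deleting a free element, or contracting an isthmus, commutes with
   all later steps, so a subword of the word of M gives a minor of M; and words
   over a two-letter alphabet are well-quasi-ordered by the subword order. *)

(** * Words over a two-letter alphabet *)

(** A whole chain, not just one related pair, so that the induction can refine one subsequence by
    another. *)
Definition has_chain (A : Type) (R : rel A) (u : nat -> A) : Prop :=
  exists2 phi : nat -> nat, {homo phi : i j / i < j} &
    forall i j, i < j -> R (u (phi i)) (u (phi j)).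

Lemma infinite_subsequence (P : nat -> Prop) :
  (forall N, exists n, N < n /\ P n) ->
  exists2 phi : nat -> nat, {homo phi : i j / i < j} & forall i, P (phi i).
Proof.
(* Choice gives a later index satisfying [P]; iterating [i.+1] times makes even the first term one
   of its outputs. *)
move=> /functional_choice[nxt nxtP]; exists (fun i => iter i.+1 nxt 0).
  apply: homo_ltn => [|i]; first exact: ltn_trans.
  exact: (nxtP _).1.
by move=> i; exact: (nxtP _).2.
Qed.

(** Take the indices after which [f] never drops below its current value. They occur arbitrarily
    late: after any other index [f] takes a smaller value, and this descent stops. *)
Lemma nat_has_chain (f : nat -> nat) : has_chain leq f.
Proof.
pose P n := forall m, n < m -> f n <= f m.
suff /infinite_subsequence[phi phi_lt phiP] : forall N, exists n, N < n /\ P n.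
  by exists phi => // i j /phi_lt; exact: phiP.
move=> N; suff H k n : f n <= k -> N < n -> exists n, N < n /\ P n.
  exact: (H (f N.+1) N.+1).
elim: k n => [|k IHk] n fnk Nn.
  by exists n; split=> // m _; apply: leq_trans fnk _.
have [Pn|/not_all_ex_not[m]] := classic (P n); first by exists n.
case: (ltnP n m) => [nm nPm|_ []//]; apply: (IHk m); last exact: ltn_trans nm.
rewrite -ltnS; apply: leq_trans fnk; rewrite ltnNge.
by apply/negP => fnm; apply: nPm.
Qed.

Lemma bool_constant_subsequence (b : nat -> bool) :
  exists c, exists2 phi : nat -> nat, {homo phi : i j / i < j} &
    forall i, b (phi i) = c.
Proof.
have [inf|] := classic (forall N, exists n, N < n /\ b n).
  by exists true; have [phi] := infinite_subsequence inf; exists phi.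
move=> /not_all_ex_not[N finN]; exists false; exists (fun i => N + i.+1).
  by move=> i j ij; rewrite ltn_add2l ltnS.
move=> i; apply/negP => bi; apply: finN; exists (N + i.+1).
by rewrite -[X in X < _]addn0 ltn_add2l.
Qed.

Lemma leq_subseq_nseq (A : eqType) (x : A) m n :
  m <= n -> subseq (nseq m x) (nseq n x).
Proof. by move=> /subnKC <-; rewrite nseqD prefix_subseq. Qed.

(** With two letters, everything before the first [x] is [~~ x]; if [x] is absent, the second factor
    is empty. *)
Lemma bool_word_split (x : bool) (s : seq bool) :
  s = nseq (index x s) (~~ x) ++ drop (index x s) s.
Proof.
elim: s => [|y s IHs] //=; case: eqVneq => //= yx.
by rewrite -IHs; case: y x yx {IHs} => -[].
Qed.

(* A word avoiding x :: v is a power of ~~ x, possibly followed by x and then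
   by a word avoiding v. *)
Lemma avoiding_has_chain (v : seq bool) (u : nat -> seq bool) :
  (forall i, ~~ subseq v (u i)) -> has_chain subseq u.
Proof.
elim: v u => [|x v IHv] u uv; first by have := uv 0; rewrite sub0seq.
(* Pass to a subsequence on which [x] occurs always or never, then to one on which the lengths of
   the leading blocks of [~~ x] increase weakly. *)
have [[] [phi phi_lt phiP]] := bool_constant_subsequence (fun i => x \in u i);
  have [psi psi_lt psiP] := nat_has_chain (fun i => index x (u (phi i))).
  have dropE i : drop (index x (u (phi i))) (u (phi i)) =
      x :: drop (index x (u (phi i))).+1 (u (phi i)).
    by rewrite (drop_nth x) ?index_mem ?nth_index.
  (* A tail after the first [x] containing [v] would put [x :: v] into the word, so the induction
     hypothesis applies to the tails. *)
  have [i|chi chi_lt chiP] :=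
      IHv (fun i => drop (index x (u (phi (psi i)))).+1 (u (phi (psi i)))).
    apply: contra (uv (phi (psi i))) => vs.
    rewrite (bool_word_split x (u _)) dropE -[x :: v]cat0s.
    by rewrite cat_subseq ?sub0seq //= eqxx.
  exists (phi \o psi \o chi) => [i j ij|i j ij] /=.
    by do 3!apply/phi_lt || apply/psi_lt || apply/chi_lt.
  rewrite (bool_word_split x (u (phi (psi (chi i))))).
  rewrite (bool_word_split x (u (phi (psi (chi j))))) !dropE.
  by rewrite cat_subseq ?leq_subseq_nseq ?psiP ?chi_lt //= eqxx chiP.
have nseqE i : u (phi i) = nseq (index x (u (phi i))) (~~ x).
  by rewrite [LHS](bool_word_split x) drop_oversize ?cats0 // memNindex ?phiP.
exists (phi \o psi) => [i j ij|i j ij] /=; first exact/phi_lt/psi_lt.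
by rewrite nseqE [X in subseq _ X]nseqE leq_subseq_nseq ?psiP.
Qed.

(** Either [u 0] embeds in a later word, or all later words avoid [u 0] and contain a chain. *)
Lemma bool_higman (u : nat -> seq bool) :
  exists i j, i < j /\ subseq (u i) (u j).
Proof.
have [[j u0j]|no] := classic (exists j, subseq (u 0) (u j.+1)).
  by exists 0, j.+1.
have [i|phi phi_lt phiP] := @avoiding_has_chain (u 0) (fun i => u i.+1).
  by apply/negP => u0i; apply: no; exists i.
by exists (phi 0).+1, (phi 1).+1; rewrite ltnS phi_lt ?phiP.
Qed.

(** * Minors as embeddings *)

(** [contract] asks for some basis of [X]; this lets any basis serve. Extend [D'] to a maximal
    independent subset [J] of [I :|: X]: it meets [X] in [D'] and has at least [#|I :|: D|]
    elements, which forces [J = I :|: D']. *)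
Lemma basis_of_exchange (T : finType) (M : matroid T) (X D D' I : {set T}) :
  is_basis_of M X D -> is_basis_of M X D' -> [disjoint I & X] ->
  I :|: D \in indep M -> I :|: D' \in indep M.
Proof.
move=> /basis_ofP[DI DX Dmax] /basis_ofP[D'I D'X D'max] IX ID.
pose p A := (A \in indep M) && (A \subset I :|: X).
have pD' : p D' by rewrite /p D'I subsetU // D'X orbT.
have [J /maxsetP[/andP[JI JIX] Jmax] D'J] := maxset_exists pD'.
have cJ : #|I :|: D| <= #|J|.
  rewrite leqNgt; apply/negP => lt.
  have [x [xID xJ xJI]] := indep_aug JI ID lt.
  suff eJ : x |: J = J by rewrite -eJ setU11 in xJ.
  apply: Jmax; rewrite ?subsetUr // /p xJI subUset sub1set JIX andbT.
  by apply: subsetP xID; rewrite setUS.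
have JX : J :&: X = D'.
  apply/esym/eqP; rewrite eqEcard subsetI D'J D'X D'max ?subsetIr //.
  by apply: indepS JI _; apply: subsetIl.
have sJ : J \subset I :|: D'.
  by apply/subsetP=> y yJ; have := subsetP JIX y yJ; rewrite !inE -JX inE yJ.
suff <- : J = I :|: D' by [].
apply/eqP; rewrite eqEcard sJ; apply: leq_trans cJ.
have dI (Z : {set T}) : Z \subset X -> #|I :|: Z| = #|I| + #|Z|.
  move=> ZX; apply/eqP; rewrite (leq_card_setU I Z).
  by rewrite disjoint_sym (disjointWl ZX) // disjoint_sym.
by rewrite !dI // leq_add2l Dmax.
Qed.

Notation carrier M := {x | x \in ground M}.

(* B is an independent set to contract, the elements outside B and the image of
   g are deleted. *)
Definition embeds (T T' : finType) (N : matroid T) (M : matroid T') : Prop :=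
  exists (g : carrier N -> carrier M) (B : {set carrier M}),
    [/\ injective g, forall x, g x \notin B
      & forall I : {set carrier N},
          (val @: (g @: I :|: B) \in indep M) = (val @: I \in indep N)].

Lemma embeds_refl (T : finType) (M : matroid T) : embeds M M.
Proof.
exists id, set0; split=> // [x|I]; first by rewrite inE.
by rewrite setU0 imset_id.
Qed.

Lemma embeds_trans (T1 T2 T3 : finType) (M1 : matroid T1) (M2 : matroid T2)
    (M3 : matroid T3) :
  embeds M1 M2 -> embeds M2 M3 -> embeds M1 M3.
Proof.
move=> [g [B [g_inj gB gI]]] [h [C [h_inj hC hI]]].
(* The set contracted overall is [C] together with the copy of [B] in [M3]. *)
exists (h \o g), (h @: B :|: C); split=> [|x|I]; first exact: inj_comp.
  by rewrite /= inE negb_or hC mem_imset // gB.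
by rewrite imset_comp setUA -imsetU hI gI.
Qed.

Lemma mem_ground_minor (T : finType) (M : matroid T) (X Y : {set T}) x :
  (x \in ground (delete (contract M X) Y)) =
    [&& x \notin Y, x \notin X & x \in ground M].
Proof. by rewrite !inE. Qed.

Lemma mem_indep_minor (T : finType) (M : matroid T) (X Y D I : {set T}) :
  is_basis_of M X D -> I \subset ground (delete (contract M X) Y) ->
  (I \in indep (delete (contract M X) Y)) = (I :|: D \in indep M).
Proof.
move=> DX IE; rewrite inE inE IE andbT.
have IX : I \subset ground M :\: X by apply: subset_trans IE (subsetDl _ _).
rewrite IX /=; apply/existsP/idP => [[D' /andP[D'X]]|ID].
  apply: (basis_of_exchange D'X DX).
  by move: IX; rewrite subsetD => /andP[].
by exists D; rewrite DX.
Qed.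

Lemma minor_le_embeds (N M : finite_matroid) :
  minor_le N M -> embeds (projT2 N) (projT2 M).
Proof.
move: N M => [T N] [T' M] [N' [X [Y [XE YE _ ->]]]] [f f_bij fI] /=.
simpl in *.
have [D DX] := basis_of_exists M X; have [DI sDX _] := basis_ofP _ _ _ DX.
have fM x : val (f x) \in ground M.
  by have := valP (f x); rewrite mem_ground_minor => /and3P[].
have fX x : val (f x) \notin X.
  by have := valP (f x); rewrite mem_ground_minor => /and3P[].
(* [X] may be dependent, so a basis [D] of it is contracted and the rest of [X] counts as
   deleted. *)
exists (fun x => Sub (val (f x)) (fM x)), [set y | val y \in D]; split.
- by move=> x y /(congr1 val); rewrite !SubK => /val_inj/(bij_inj f_bij).
- by move=> x; rewrite inE SubK; apply: contra (fX x); apply: (subsetP sDX).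
move=> I; rewrite -fI imsetU -imset_comp /comp /=.
have -> : val @: [set y : carrier M | val y \in D] = D.
  apply/setP=> y; apply/imsetP/idP => [[z]|yD]; first by rewrite inE => ? ->.
  by exists (Sub y (subsetP (indep_ground DI) y yD)); rewrite ?inE.
rewrite [RHS](mem_indep_minor DX) //.
by apply/subsetP=> _ /imsetP[x _ ->]; exact: valP.
Qed.

Lemma embeds_minor_le (N M : finite_matroid) :
  embeds (projT2 N) (projT2 M) -> minor_le N M.
Proof.
move: N M => [T N] [T' M] [g [B [g_inj gB gI]]] /=; simpl in *.
pose X := val @: B; pose Z := val @: [set g x | x : carrier N].
have sE (A : {set carrier M}) : val @: A \subset ground M.
  by apply/subsetP=> _ /imsetP[x _ ->]; exact: valP.
(* The case [I = set0] shows that [X] is independent, hence a basis of itself. *)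
have XI : X \in indep M.
  have := gI set0; rewrite !imset0 set0U => ->; exact: indep0.
have XB : is_basis_of M X X.
  by apply/basis_ofP; split=> // A _; exact: subset_leq_card.
have gX x : val (g x) \notin X by rewrite mem_imset ?gB //; exact: val_inj.
pose Y := ground M :\: X :\: Z.
have groundE : ground (delete (contract M X) Y) = Z.
  apply/setP=> y; rewrite mem_ground_minor !inE.
  have [|yZ] := boolP (y \in Z); last by case: (y \in X); case: (y \in ground M).
  by case/imsetP=> _ /imsetP[x _ ->] ->; rewrite gX (valP (g x)).
exists (delete (contract M X) Y).
  exists X, Y; split=> //; first by rewrite sE.
    by rewrite /Y setDDl subsetDl.
  rewrite -setI_eq0 -subset0; apply/subsetP=> y.
  by rewrite !inE => /andP[->]; rewrite andbF.
have gZ x : val (g x) \in ground (delete (contract M X) Y).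
  by rewrite groundE imset_f // imset_f.
exists (fun x => Sub (val (g x)) (gZ x)) => [|I].
  apply: inj_card_bij => [x y /(congr1 val)|].
    by rewrite !SubK => /val_inj/g_inj.
  rewrite card_sig (eq_card (B := Z)) => [|y]; last by rewrite -groundE.
  by rewrite /Z card_imset ?card_imset ?cardsT //; exact: val_inj.
rewrite [LHS](mem_indep_minor XB) -?gI ?imsetU.
  by rewrite -imset_comp.
by apply/subsetP=> _ /imsetP[x _ ->]; exact: valP.
Qed.

(** * Nested matroids as words *)

Lemma setD1_notin (T : finType) (A : {set T}) x : x \notin A -> A :\ x = A.
Proof. by move=> xA; apply/setDidPl; rewrite disjoint_sym disjoints1. Qed.

Section Codes.
Variable T : finType.
Implicit Types (s : seq (bool * T)) (I : {set T}).

(** This is the rank: an isthmus raises it by one, a free extension keeps it. *)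
Definition code_rank s := count id (unzip1 s).

(* The letter true adds an isthmus, false takes a free extension; the last
   element added comes first. *)
Fixpoint code_indep s I : bool :=
  if s is (b, e) :: s' then
    code_indep s' (I :\ e) &&
      (b || ((e \in I) ==> (#|I :\ e| < code_rank s')))
  else I == set0.

Definition codes s (M : matroid T) : Prop :=
  [/\ uniq (unzip2 s), ground M =i unzip2 s
    & forall I, (I \in indep M) = code_indep s I].

Lemma code_indep_card s I : code_indep s I -> #|I| <= code_rank s.
Proof.
elim: s I => [|[b e] s IHs] I /=; first by move/eqP->; rewrite cards0.
case/andP=> /IHs; rewrite (cardsD1 e I) /code_rank /=.
case: b; case: (e \in I) => //= h _; rewrite ?add0n ?add1n ?ltnS //.
exact: leqW.
Qed.

(** The isthmuses form a basis, so the bound of [code_indep_card] is attained. *)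
Lemma code_basis s : uniq (unzip2 s) ->
  exists I, [/\ {subset I <= unzip2 s}, code_indep s I & #|I| = code_rank s].
Proof.
elim: s => [_|[b e] s IHs /= /andP[es /IHs[I [Is Ii Ic]]]].
  by exists set0; split=> [x||]; rewrite ?inE ?cards0 /=.
have eI : e \notin I by apply: contra es => /Is.
case: b.
  exists (e |: I); rewrite /= setU1K // Ii cardsU1 eI Ic; split=> // x.
  by rewrite !inE => /orP[->|/Is->]; rewrite ?orbT.
exists I; rewrite (negbTE eI) /= andbT Ic; split=> // [x /Is xs|].
  by rewrite inE xs orbT.
by rewrite setD1_notin.
Qed.

Lemma nested_codes (M : matroid T) : nested M -> exists s, codes s M.
Proof.
elim=> {M} [|M e eM _ [s [us sM sI]]|M e eM _ [s [us sM sI]]].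
- by exists [::]; split=> // [x|I]; rewrite ?inE.
- exists ((true, e) :: s); split=> [|x|I] /=; rewrite -?sM ?eM ?inE ?sM //.
  by rewrite andbT sI.
exists ((false, e) :: s); split=> [|x|I] /=; first by rewrite -sM eM.
  by rewrite !inE sM.
(* An independent set of [M] larger than [I :\ e] exists exactly when [#|I :\ e|] is below the
   rank. *)
apply/(free_extension_indepP _ eM)/andP; rewrite sI => -[Ii eI]; split=> //.
  apply/implyP => /eI[J]; rewrite sI => /code_indep_card Jc lt.
  exact: leq_trans lt Jc.
move/(implyP eI) => lt; have [J [_ Ji Jc]] := code_basis us.
by exists J; rewrite ?sI ?Jc.
Qed.

End Codes.

(** * Embeddings along subwords *)

(* The rank condition says that contracting B lowers the rank of the larger
   matroid to that of the smaller one, so that free extensions correspond. *)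
Definition code_embedding (T T' : finType) (s : seq (bool * T))
    (t : seq (bool * T')) (g : T -> T') (B : {set T'}) : Prop :=
  [/\ {in unzip2 s &, injective g},
      {in unzip2 s, forall x, g x \in unzip2 t /\ g x \notin B},
      {subset B <= unzip2 t},
      #|B| + code_rank s = code_rank t
    & forall I : {set T}, {subset I <= unzip2 s} ->
        code_indep t (g @: I :|: B) = code_indep s I].

Lemma code_embedding_notin (T T' : finType) (s : seq (bool * T))
    (t : seq (bool * T')) (g : T -> T') (B : {set T'}) (f : T') (I : {set T}) :
  code_embedding s t g B -> f \notin unzip2 t -> {subset I <= unzip2 s} ->
  f \notin g @: I :|: B.
Proof.
move=> [_ gP Bt _ _] ft Is; apply: contra ft; rewrite inE.
by case/orP=> [/imsetP[x /Is /gP[xt _] ->]|/Bt].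
Qed.

(** An unmatched isthmus joins [B], raising [#|B|] and the rank together; an unmatched free element
    stays outside [B] and the image, hence is deleted. *)
Lemma code_embedding_skip (T T' : finType) (s : seq (bool * T))
    (t : seq (bool * T')) (g : T -> T') (B : {set T'}) (c : bool) (f : T') :
  f \notin unzip2 t -> code_embedding s t g B ->
  code_embedding s ((c, f) :: t) g (if c then f |: B else B).
Proof.
move=> ft gB; have fgB := code_embedding_notin gB ft.
case: gB => [g_inj gP Bt rB gI]; have fB : f \notin B by apply: contra ft => /Bt.
case: c; last first.
  split=> // [x /gP[xt xB]|x /Bt xt|I Is]; rewrite ?inE ?xt ?orbT //.
  by rewrite /= setD1_notin ?fgB // gI // (negbTE (fgB I Is)) andbT.
split=> // [x xs|x||I Is].
- have [xt xB] := gP x xs; rewrite !inE xt orbT negb_or xB andbT; split=> //.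
  by apply: contraNneq ft => <-.
- by rewrite !inE => /orP[->|/Bt->]; rewrite ?orbT.
- by rewrite cardsU1 fB -addnA rB.
by rewrite /= setUCA setU1K ?andbT ?gI // fgB.
Qed.

(** For a free letter, the bounds on [I :\ e] and on its image with [B] agree: size and rank both
    shift by [#|B|], as the image is disjoint from [B]. *)
Lemma code_embedding_cons (T T' : finType) (s : seq (bool * T))
    (t : seq (bool * T')) (g : T -> T') (B : {set T'}) (b : bool) (e : T)
    (f : T') :
  e \notin unzip2 s -> f \notin unzip2 t -> code_embedding s t g B ->
  code_embedding ((b, e) :: s) ((b, f) :: t)
    (fun x => if x == e then f else g x) B.
Proof.
move=> es ft gB; have fgB := code_embedding_notin gB ft.
case: gB => [g_inj gP Bt rB gI]; pose g' x := if x == e then f else g x.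
have fB : f \notin B by apply: contra ft => /Bt.
have g'e : g' e = f by rewrite /g' eqxx.
have g's : {in unzip2 s, g' =1 g}.
  by move=> x xs; rewrite /g'; case: eqVneq xs => // ->; rewrite (negbTE es).
have gf x : x \in unzip2 s -> (g x == f) = false.
  by move=> xs; apply/negP => /eqP gxf; case: (gP x xs); rewrite gxf (negbTE ft).
rewrite -/g'; split=> /=.
- move=> x y; rewrite !inE => /orP[/eqP->|xs] /orP[/eqP->|ys] //.
  + by rewrite g'e g's // => /esym/eqP; rewrite gf.
  + by rewrite g'e g's // => /eqP; rewrite gf.
  + by rewrite !g's //; exact: g_inj.
- move=> x; rewrite !inE => /orP[/eqP->|xs]; first by rewrite g'e eqxx.
  by rewrite g's //; have [-> ->] := gP x xs; rewrite orbT.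
- by move=> x /Bt xt; rewrite inE xt orbT.
- by rewrite /code_rank /= addnCA -/(code_rank s) rB.
move=> I Is; have Ies : {subset I :\ e <= unzip2 s}.
  move=> x; rewrite !inE => /andP[/negbTE xe /Is].
  by rewrite inE xe.
have g'I : g' @: (I :\ e) = g @: (I :\ e).
  by apply: eq_in_imset => x /Ies; exact: g's.
have imD : (g' @: I :|: B) :\ f = g @: (I :\ e) :|: B.
  have [eI|eI] := boolP (e \in I).
    rewrite -(setD1K eI) imsetU1 g'e g'I -setUA setU1K ?setU1K //.
      by rewrite !inE eqxx.
    exact: fgB.
  by rewrite -[in LHS](setD1_notin eI) g'I setD1_notin // fgB.
have fI : (f \in g' @: I :|: B) = (e \in I).
  rewrite inE (negbTE fB) orbF; apply/imsetP/idP => [[x xI]|eI].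
    have := Is x xI; rewrite inE => /orP[/eqP<- //|xs].
    by rewrite g's // => /esym/eqP; rewrite gf.
  by exists e; rewrite ?g'e.
have cI : #|g @: (I :\ e) :|: B| = #|I :\ e| + #|B|.
  rewrite -(card_in_imset (f := g)); last by move=> x y /Ies xs /Ies; exact: g_inj.
  apply/eqP; rewrite (leq_card_setU _ _) -setI_eq0 -subset0.
  apply/subsetP=> _ /setIP[/imsetP[x /Ies xs ->]].
  by case: (gP x xs) => _ /negbTE->.
by rewrite imD fI gI // cI addnC -rB ltn_add2l.
Qed.

(** [subseq] matches greedily: equal heads extend the embedding, any other head of [t] is skipped.
    The value [d] provides a map when both words are empty. *)
Lemma subseq_code_embedding (T T' : finType) (d : T') (s : seq (bool * T))
    (t : seq (bool * T')) :
  uniq (unzip2 s) -> uniq (unzip2 t) -> subseq (unzip1 s) (unzip1 t) ->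
  exists (g : T -> T') (B : {set T'}), code_embedding s t g B.
Proof.
elim: t s => [|[c f] t IHt] s us.
  case: s us => // us _ _; exists (fun=> d), set0.
  split=> // [x|/=|I Is]; rewrite ?inE ?cards0 //=.
  suff -> : I = set0 by rewrite imset0 setU0 !eqxx.
  by apply/setP=> x; rewrite inE; apply/negP => /Is.
rewrite [unzip2 _]/= => /=/andP[ft ut].
have skip : subseq (unzip1 s) (unzip1 t) ->
    exists (g : T -> T') (B : {set T'}), code_embedding s ((c, f) :: t) g B.
  move=> /(IHt s us ut)[g [B gB]].
  by do 2!eexists; exact: code_embedding_skip gB.
case: s us skip => [|[b e] s] us skip; first by move=> _; exact/skip/sub0seq.
rewrite [unzip1 _]/= => /=; case: eqVneq => [eqbc st|_]; last exact: skip.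
subst c; move: us => /=/andP[es us]; have [g [B gB]] := IHt s us ut st.
by do 2!eexists; exact: code_embedding_cons gB.
Qed.

Lemma codes_embeds (T T' : finType) (N : matroid T) (M : matroid T') s t :
  codes s N -> codes t M -> subseq (unzip1 s) (unzip1 t) -> embeds N M.
Proof.
move=> [us sN NI] [ut tM MI] st.
(* If [T'] is empty no default value exists, but then [t], [s] and the ground set of [N] are empty
   too. *)
have [d _|T'0] := pickP (fun _ : T' => true); last first.
  have s0 : s = [::].
    by case: s t st {us ut sN tM NI MI} => [|? ?] [|[c f] t] //; have := T'0 f.
  have N0 x : x \notin ground N by rewrite sN s0.
  exists (fun x => False_rect _ (negP (N0 (val x)) (valP x))), set0.
  split=> [x|x|I]; try by case: (negP (N0 (val x)) (valP x)).
  have -> : I = set0 by apply/setP=> x; case: (negP (N0 (val x)) (valP x)).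
  by rewrite !imset0 setU0 imset0 !indep0.
have [g [B [g_inj gP Bt _ gI]]] := subseq_code_embedding d us ut st.
have gM (x : carrier N) : g (val x) \in ground M.
  by rewrite tM; have := valP x; rewrite sN => /gP[].
exists (fun x => Sub (g (val x)) (gM x)), [set y | val y \in B]; split.
- move=> x y /(congr1 val); rewrite !SubK => /g_inj gxy.
  by apply/val_inj/gxy; rewrite -sN; exact: valP.
- by move=> x; rewrite inE SubK; have := valP x; rewrite sN => /gP[].
move=> I; rewrite imsetU -imset_comp /comp /=.
have -> : val @: [set y : carrier M | val y \in B] = B.
  apply/setP=> y; apply/imsetP/idP => [[z]|yB]; first by rewrite inE => ? ->.
  have yM : y \in ground M by rewrite tM; exact: Bt.
  by exists (Sub y yM); rewrite ?inE.
rewrite MI NI -gI; first by rewrite -imset_comp.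
by move=> _ /imsetP[x _ ->]; rewrite -sN; exact: valP.
Qed.

Theorem theorem5p4 :
  well_quasi_ordered nested_matroid minor_le /\
  ~ infinite_antichain nested_matroid minor_le.
Proof.
have good (u : nat -> finite_matroid) : (forall i, nested_matroid (u i)) ->
    exists i j, i < j /\ minor_le (u i) (u j).
  move=> nu; pose coded i w :=
    exists2 s, codes s (projT2 (u i)) & unzip1 s = w.
  (* Choose one word for each [u i]. *)
  have [i|w wP] := @functional_choice _ _ coded.
    by have [s us] := nested_codes (nu i); exists (unzip1 s), s.
  have [i [j [ij wij]]] := bool_higman w; exists i, j; split=> //.
  have [s si eqs] := wP i; have [t tj eqt] := wP j.
  by apply/embeds_minor_le/(codes_embeds si tj); rewrite eqs eqt.
split; last first.
  move=> [u [_ nu anti]]; have [i [j [ij uij]]] := good u nu.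
  by apply: (anti i j) => // eqij; rewrite eqij ltnn in ij.
split=> //; split=> [M _|M N P _ _ _ MN NP].
  exact/embeds_minor_le/embeds_refl.
(* Transitivity goes through embeddings, which compose directly. *)
apply: embeds_minor_le.
exact: embeds_trans (minor_le_embeds MN) (minor_le_embeds NP).
Qed.
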